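(* For every $\varepsilon>0$ there is an integer $\ell_\varepsilon$ such that, with high probability (as $n\to\infty$), there is no graph homomorphism from $G\sim G\left(n,\frac{1+\varepsilon}{n}\right)$ to $C_{2\ell+1}$ for any $\ell\ge \ell_\varepsilon$. Moreover, one can take $\ell_\varepsilon = O\!\left(\frac{1}{\varepsilon^3}\right)$.
   Context: $G(n,p)$ is the binomial random graph on $n$ labeled vertices with each edge present independently with probability $p$. $C_r$ denotes the cycle on $r$ vertices. A graph homomorphism from $G$ to $G'$ is a map $\varphi:V(G)\to V(G')$ such that $\{\varphi(u),\varphi(v)\}\in E(G')$ whenever $\{u,v\}\in E(G)$. *)

(* Defs.v *)
From mathcomp Require Import all_boot all_order all_algebra.
From mathcomp Require Import all_classical all_reals all_analysis.

Set Implicit Arguments.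
Unset Strict Implicit.
Unset Printing Implicit Defensive.

Import Order.TTheory GRing.Theory Num.Theory.
Local Open Scope ring_scope.

(* A graph with vertex type T is represented by its edge set E : {set {set T}};
   it is simple exactly when E \subset vpairs T. *)
Definition vpairs (T : finType) : {set {set T}} :=
  [set e : {set T} | #|e| == 2%N]%SET.

Definition graph_hom (T T' : finType) (E : {set {set T}}) (E' : {set {set T'}})
    (f : T -> T') : Prop :=
  forall u v : T, [set u; v]%SET \in E -> [set f u; f v]%SET \in E'.

(* [ordS i] is i + 1 modulo r; this is the cycle C_r for r >= 3. *)
Definition cycle_graph (r : nat) : {set {set 'I_r}} :=
  [set [set i; ordS i]%SET | i : 'I_r]%SET.

Lemma cycle_graph_simple (r : nat) :
  (1 < r)%N -> cycle_graph r \subset vpairs 'I_r.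
Proof.
move=> r1; apply/fintype.subsetP => _ /finset.imsetP[i _ ->].
rewrite inE cards2; case: (i =P ordS i) => // /(congr1 (@nat_of_ord r)) /= ir.
have := ltn_ord i; rewrite leq_eqVlt => /orP[/eqP ir'|ir'].
  by move: ir; rewrite ir' modnn => i0; rewrite -ir' i0 in r1.
by move: ir => /eqP; rewrite modn_small// ltn_eqF.
Qed.

(* The mass G(n, p) gives to the simple graph on 'I_n with edge set E: the
   product over all potential edges of the Bernoulli(p) masses. *)
Definition gnp_mass (R : realType) (n : nat) (p : R)
    (E : {set {set 'I_n}}) : R :=
  \prod_(e in vpairs 'I_n) (if e \in E then p else 1 - p).

(* Probability of the event A under G(n, p). This is a probability only for
   0 <= p <= 1; with p = c / n this excludes only the finitely many n with
   0 < n < c, which do not affect limits as n goes to infinity. *)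
Definition gnp_prob (R : realType) (n : nat) (p : R)
    (A : set {set {set 'I_n}}) : R :=
  \sum_(E in powerset (vpairs 'I_n) | `[< A E >]) gnp_mass p E.
Arguments gnp_prob {R} n p A.

Lemma gnp_prob_setT (R : realType) (n : nat) (p : R) :
  gnp_prob n p [set: {set {set 'I_n}}]%classic = 1.
Proof.
pose V := vpairs 'I_n.
transitivity (\prod_e ((if e \in V then p else 0) +
                       (if e \in V then 1 - p else 1))); last first.
  by apply: big1 => e _; case: ifP => _; rewrite ?add0r// addrC subrK.
rewrite bigA_distr /gnp_prob big_mkcond /=; apply: eq_bigr => E _.
rewrite asboolT// andbT powersetE; case: ifPn => [EV|].
  rewrite /gnp_mass big_mkcond; apply: eq_bigr => e _ /=; rewrite -/V.
  by have := fintype.subsetP EV e; case: (e \in E); case: (e \in V) => // /(_ isT).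
move=> /subsetPn[e eE eV]; rewrite (bigD1 e)//= eE (negbTE eV) mul0r//.
Qed.

(* Main.v *)
Require Import Defs.
From mathcomp Require Import all_boot all_order all_algebra.
From mathcomp Require Import all_classical all_reals all_analysis.
From mathcomp Require Import ring lra zify.

Set Implicit Arguments.
Unset Strict Implicit.
Unset Printing Implicit Defensive.

Import Order.TTheory GRing.Theory Num.Theory.
Import numFieldNormedType.Exports.
Local Open Scope ring_scope.

(* Put d = min(eps, 1) and expose G(n, (1 + eps)/n) in two independent rounds,
   the first one with edge probability p1 = (1 + d/2)/n, the second one with
   edge probability at least d/(2n).

   First round.  Exploring from a fixed set A of k vertices, the probability of
   discovering fewer than m = d n/32 further vertices is at most
   (1 - d/8)^k.  Otherwise there is a forest F with m edges, spanning a set S of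
   k + m vertices, all of whose components meet A.

   Second round.  Cutting C_r at each of its r edges turns a homomorphism to C_r
   into r colourings of the vertices with two colours, such that every edge of
   the graph is monochromatic for exactly one of them.  Hence some colouring has
   a proportion at most 2/r of monochromatic edges both in F and among the
   second-round edges inside S.  Each colouring of S satisfies the second
   condition with probability at most exp(-c d^3 n), since at least about half
   of the pairs in S are monochromatic, while, if r is a large multiple of
   d^-3, at most 2^k exp(c d^3 n/2) colourings of S satisfy the first one.
   Conclude by a union bound, letting n and then k tend to infinity. *)

(** * Expectations over binomial random subsets *)

Lemma big_powersetU1 (R : nmodType) (I : finType) (D : {set I}) (e : I)
    (F : {set I} -> R) : e \notin D ->
  \sum_(E in powerset (e |: D)%SET) F E =
  \sum_(E in powerset D) F E + \sum_(E in powerset D) F (e |: E)%SET.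
Proof.
move=> eD; rewrite (bigID (fun E : {set I} => e \in E)) /= addrC; congr (_ + _).
  apply: eq_bigl => E; rewrite !powersetE.
  apply/andP/idP => [[/fintype.subsetP ED eE]|/fintype.subsetP ED].
    apply/fintype.subsetP => i iE; have := ED _ iE; rewrite in_setU1.
    by case: eqP => // ie; rewrite -ie iE in eE.
  split; first by apply/fintype.subsetP => i /ED iD; rewrite in_setU1 iD orbT.
  by apply: contra eD => /ED.
rewrite (reindex_onto (fun E => e |: E)%SET (fun E => E :\ e)%SET) /=; last first.
  by move=> E /andP[_ eE]; rewrite finset.setD1K.
apply: eq_bigl => E; rewrite !powersetE setU11 andbT.
apply/andP/idP => [[/fintype.subsetP ED /eqP EE]|/fintype.subsetP ED].
  apply/fintype.subsetP => i iE; have := ED i; rewrite !in_setU1 iE orbT => /(_ isT).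
  by case: eqP => // ie; move: iE; rewrite -EE ie !inE eqxx.
split.
  by apply/fintype.subsetP => i; rewrite !in_setU1 => /orP[->//|/ED ->]; rewrite orbT.
by rewrite setU1K//; apply: contra eD => /ED.
Qed.

(* Expectation of F E for a random subset E of D, each element being kept
   independently with probability p. *)
Definition bexp (R : realType) (I : finType) (p : R) (D : {set I})
    (F : {set I} -> R) : R :=
  \sum_(E in powerset D) (\prod_(e in D) (if e \in E then p else 1 - p)) * F E.

Lemma bexp0 (R : realType) (I : finType) (p : R) (F : {set I} -> R) :
  bexp p finset.set0 F = F finset.set0.
Proof.
by rewrite /bexp powerset0 big_set1 big_pred0 ?mul1r// => i; rewrite inE.
Qed.

Lemma bexpU1 (R : realType) (I : finType) (p : R) (D : {set I}) (e : I)
    (F : {set I} -> R) : e \notin D ->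
  bexp p (e |: D)%SET F =
  p * bexp p D (fun E => F (e |: E)%SET) + (1 - p) * bexp p D F.
Proof.
move=> eD; rewrite /bexp big_powersetU1// addrC !mulr_sumr.
congr (_ + _); apply: eq_bigr => E; rewrite powersetE => /fintype.subsetP ED.
  rewrite big_setU1//= setU11 !mulrA; congr (_ * _ * _).
  apply: eq_bigr => i iD; rewrite in_setU1; case: eqP => // ie.
  by rewrite ie (negbTE eD) in iD.
rewrite big_setU1//= ifN ?mulrA//; by apply: contra eD => /ED.
Qed.

Lemma bexpD1 (R : realType) (I : finType) (p : R) (D : {set I}) (e : I)
    (F : {set I} -> R) : e \in D ->
  bexp p D F =
  p * bexp p (D :\ e)%SET (fun E => F (e |: E)%SET) + (1 - p) * bexp p (D :\ e)%SET F.
Proof. by move=> eD; rewrite -{1}(finset.setD1K eD) bexpU1// !inE eqxx. Qed.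

Lemma finset_ind (I : finType) (P : {set I} -> Prop) :
  P finset.set0 -> (forall (D : {set I}) e, e \notin D -> P D -> P (e |: D)%SET) ->
  forall D, P D.
Proof.
move=> P0 PU D; elim: {D}#|D| {-2}D (erefl #|D|) => [D /eqP|n IH D Dn].
  by rewrite cards_eq0 => /eqP ->.
have /card_gt0P[e eD] : (0 < #|D|)%N by rewrite Dn.
rewrite -(finset.setD1K eD); apply: PU; first by rewrite !inE eqxx.
by apply: IH; move: (cardsD1 e D); rewrite eD Dn => -[].
Qed.

Lemma le_bexp (R : realType) (I : finType) (p : R) (D : {set I})
    (F G : {set I} -> R) : 0 <= p <= 1 ->
  (forall E : {set I}, E \subset D -> F E <= G E) -> bexp p D F <= bexp p D G.
Proof.
move=> /andP[p0 p1] FG; apply: ler_sum => E; rewrite powersetE => ED.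
apply: ler_wpM2l; last exact: FG.
by apply: prodr_ge0 => e _; case: ifP => _ //; rewrite subr_ge0.
Qed.

Lemma bexp_cst (R : realType) (I : finType) (p : R) (D : {set I}) (c : R) :
  bexp p D (fun=> c) = c.
Proof.
elim/finset_ind: D => [|D e eD IH]; first by rewrite bexp0.
by rewrite bexpU1// IH -mulrDl addrC subrK mul1r.
Qed.

Lemma bexpD (R : realType) (I : finType) (p : R) (D : {set I})
    (F G : {set I} -> R) :
  bexp p D (fun E => F E + G E) = bexp p D F + bexp p D G.
Proof. by rewrite /bexp -big_split /=; apply: eq_bigr => E _; rewrite mulrDr. Qed.

Lemma bexpZ (R : realType) (I : finType) (p : R) (D : {set I}) (c : R)
    (F : {set I} -> R) :
  bexp p D (fun E => c * F E) = c * bexp p D F.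
Proof. by rewrite /bexp mulr_sumr; apply: eq_bigr => E _; rewrite mulrCA. Qed.

Lemma bexp_sum (R : realType) (I J : finType) (p : R) (D : {set I})
    (P : pred J) (F : J -> {set I} -> R) :
  bexp p D (fun E => \sum_(j | P j) F j E) = \sum_(j | P j) bexp p D (F j).
Proof.
by rewrite /bexp exchange_big /=; apply: eq_bigr => E _; rewrite mulr_sumr.
Qed.

(** Independence: each element of [D] contributes [g e] with probability [p] and 1 otherwise. This
    is the exponential moment behind the second round. *)
Lemma bexp_prod (R : realType) (I : finType) (p : R) (D : {set I}) (g : I -> R) :
  bexp p D (fun E => \prod_(e in E) g e) = \prod_(e in D) (1 + p * (g e - 1)).
Proof.
elim/finset_ind: D => [|D e eD IH]; first by rewrite bexp0 !big_set0.
rewrite bexpU1// big_setU1//= -IH.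
have -> : bexp p D (fun E => \prod_(i in (e |: E)%SET) g i) =
          g e * bexp p D (fun E => \prod_(i in E) g i).
  rewrite -bexpZ; apply: eq_bigr => E; rewrite powersetE => /fintype.subsetP ED.
  by rewrite big_setU1//; apply: contra eD => /ED.
by ring.
Qed.

(** An element is missed by the union exactly when both rounds miss it, which is the hypothesis on
    [p]. The induction exposes one element at a time, in both rounds. *)
Lemma bexp_sprinkle (R : realType) (I : finType) (p p1 p2 : R) (D : {set I})
    (F : {set I} -> R) : 1 - p = (1 - p1) * (1 - p2) ->
  bexp p D F = bexp p1 D (fun E1 => bexp p2 D (fun E2 => F (E1 :|: E2)%SET)).
Proof.
move=> pE; elim/finset_ind: D F => [|D e eD IH] F.
  by rewrite !bexp0 finset.setU0.
have stepE : forall E1, bexp p2 (e |: D)%SET (fun E2 => F (E1 :|: E2)%SET) =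
   p2 * bexp p2 D (fun E2 => F (e |: (E1 :|: E2))%SET) +
   (1 - p2) * bexp p2 D (fun E2 => F (E1 :|: E2)%SET).
  move=> E1; rewrite bexpU1//; congr (_ * _ + _).
  by apply: eq_bigr => E2 _; rewrite finset.setUCA.
(* Once the first round contains [e], the second round's decision on [e] is immaterial. *)
have step2 : forall E1, bexp p2 (e |: D)%SET (fun E2 => F ((e |: E1) :|: E2)%SET) =
    bexp p2 D (fun E2 => F (e |: (E1 :|: E2))%SET).
  move=> E1; rewrite stepE.
  have -> : (fun E2 => F (e |: (e |: E1 :|: E2))%SET) = (fun E2 => F (e |: (E1 :|: E2))%SET).
    by apply: funext => E2; rewrite -finset.setUA finset.setUA finset.setUid.
  have -> : (fun E2 => F (e |: E1 :|: E2)%SET) = (fun E2 => F (e |: (E1 :|: E2))%SET).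
    by apply: funext => E2; rewrite -finset.setUA.
  by ring.
rewrite !bexpU1// (funext step2) (funext stepE) bexpD !bexpZ.
rewrite -(IH F) -(IH (fun E => F (e |: E)%SET)).
have -> : p = 1 - (1 - p1) * (1 - p2) by rewrite -pE; ring.
by ring.
Qed.

(** * Forests grown from a root set, and their two-colourings *)

(* [grown E A S F m]: the forest F, consisting of m edges of E, connects the
   m vertices of S outside A to the roots A. *)
Inductive grown (T : finType) (E : {set {set T}}) (A : {set T}) :
    {set T} -> {set {set T}} -> nat -> Prop :=
| grown0 : grown E A A finset.set0 0
| grownS S F m u w : grown E A S F m -> u \in S -> w \notin S ->
    [set u; w]%SET \in E ->
    grown E A (w |: S)%SET ([set u; w] |: F)%SET m.+1.

Lemma grown_card (T : finType) (E : {set {set T}}) (A S : {set T})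
    (F : {set {set T}}) (m : nat) :
  grown E A S F m -> #|S| = (#|A| + m)%N.
Proof. by elim=> [|S' F' m' u w _ IH _ wS _]; rewrite ?addn0// cardsU1 wS IH; lia. Qed.

Lemma grown_cardF (T : finType) (E : {set {set T}}) (A S : {set T})
    (F : {set {set T}}) (m : nat) :
  grown E A S F m -> (#|F| <= m)%N.
Proof.
elim=> [|S' F' m' u w _ IH _ wS _]; first by rewrite cards0.
by rewrite cardsU1 (leq_trans (leq_add (leq_b1 _) IH)).
Qed.

Lemma grown_edges (T : finType) (E : {set {set T}}) (A S : {set T})
    (F : {set {set T}}) (m : nat) :
  grown E A S F m -> F \subset E.
Proof.
elim=> [|S' F' m' u w _ IH _ wS uw]; first exact: finset.sub0set.
by rewrite finset.subUset finset.sub1set uw.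
Qed.

Lemma grown_inside (T : finType) (E : {set {set T}}) (A S : {set T})
    (F : {set {set T}}) (m : nat) :
  grown E A S F m -> forall e, e \in F -> e \subset S.
Proof.
elim=> [e|S' F' m' u w _ IH uS wS uw e]; first by rewrite inE.
rewrite in_setU1 => /orP[/eqP ->|/IH eS].
  by rewrite finset.subUset !finset.sub1set !in_setU1 uS eqxx orbT.
by rewrite (fintype.subset_trans eS)// finset.subsetUr.
Qed.

(** [grownS] appends a last edge, whereas the exploration finds the first edge and then goes on with
    the discovered vertex as a further root; this converts one order into the other. *)
Lemma grown_front (T : finType) (E : {set {set T}}) (A S : {set T})
    (F : {set {set T}}) (m : nat) (v c : T) :
  v \in A -> c \notin A -> [set v; c]%SET \in E ->
  grown E (c |: A)%SET S F m -> grown E A S ([set v; c] |: F)%SET m.+1.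
Proof.
move=> vA cA vcE; elim=> [|S' F' m' u w _ IH uS wS uw].
  by apply: grownS => //; exact: grown0.
by rewrite finset.setUCA; apply: grownS.
Qed.

(* A colouring with two colours is encoded by the set sigma of the vertices of
   one of the colours. *)
Definition mono (T : finType) (sigma e : {set T}) : bool :=
  (e \subset sigma) || [disjoint e & sigma].

Lemma mono_set2 (T : finType) (sigma : {set T}) u v :
  mono sigma [set u; v]%SET = ((u \in sigma) == (v \in sigma)).
Proof.
rewrite /mono finset.subUset !finset.sub1set finset.disjoints_subset.
by rewrite finset.subUset !finset.sub1set !inE; case: (u \in _); case: (v \in _).
Qed.

Lemma monoI (T : finType) (sigma S e : {set T}) :
  e \subset S -> mono (sigma :&: S)%SET e = mono sigma e.
Proof.
move=> eS; rewrite /mono finset.subsetI eS andbT -!setI_eq0.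
by rewrite finset.setIA finset.setIAC (finset.setIidPl eS).
Qed.

(* A colouring of the forest is determined by the colours of the roots and by
   its set of monochromatic edges. *)
Lemma grown_mono_sum (R : realType) (T : finType) (E : {set {set T}}) (A S : {set T})
    (F : {set {set T}}) (m : nat)
    (z : R) : grown E A S F m ->
  \sum_(sigma in powerset S) \prod_(e in F) (if mono sigma e then z else 1) =
  2 ^+ #|A| * (1 + z) ^+ m.
Proof.
elim=> [|S' F' m' u w gr IH uS wS uw].
  under eq_bigr do rewrite big_set0.
  by rewrite sumr_const card_powerset natrX mulr1.
have eF : [set u; w]%SET \notin F'.
  apply/negP => /(grown_inside gr); rewrite finset.subUset !finset.sub1set.
  by rewrite (negbTE wS) andbF.
rewrite big_powersetU1// -big_split /= exprS mulrCA -IH mulr_sumr.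
apply: eq_bigr => sigma; rewrite powersetE => /fintype.subsetP sS.
have ws : w \notin sigma by apply: contra wS => /sS.
rewrite !big_setU1//= !mono_set2 (negbTE ws) setU11 in_setU1.
have -> : (u == w) = false by apply/eqP => uw'; rewrite uw' (negbTE wS) in uS.
have -> : \prod_(e in F') (if mono (w |: sigma)%SET e then z else 1) =
          \prod_(e in F') (if mono sigma e then z else 1).
  apply: eq_bigr => e /(grown_inside gr) eS.
  rewrite -(monoI (w |: sigma)%SET eS) -(monoI sigma eS) finset.setIUl.
  suff -> : ([set w] :&: S' = finset.set0)%SET by rewrite finset.set0U.
  by apply/eqP; rewrite setI_eq0 disjoints1.
(* Exactly one of the two colours of [w] makes the new edge monochromatic, whence the factor
   [1 + z]. *)
by rewrite /=; case: (u \in sigma) => /=; ring.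
Qed.

(** * First round: exploration of the random graph *)

Definition grows (T : finType) (E : {set {set T}}) (S : {set T}) (m : nat) :=
  exists S' F, grown E S S' F m.

(* Exposing the edges from the active vertices one by one, [A] being the active
   vertices, [v] the vertex under exploration and [C] the vertices which may
   still be adjacent to [v].  Each discovered vertex consumes one vertex outside
   [S] and one unit of [m], so that the condition relating q to x is invariant. *)
Lemma exploration (R : realType) (T : finType) (p x : R) (v : T)
    (S A C : {set T}) (m : nat) (D E0 : {set {set T}}) :
  0 <= p <= 1 -> 0 <= x <= 1 ->
  (1 - p + p * x) ^+ (#|~: S|%SET - m) <= x ->
  A \subset S -> v \in S -> v \notin A -> C \subset (~: S)%SET ->
  (forall c, c \in C -> [set v; c]%SET \in D) ->
  (forall a b, a \in A -> b \notin S -> [set a; b]%SET \in D) ->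
  (forall b b', b \notin S -> b' \notin S -> b != b' -> [set b; b']%SET \in D) ->
  bexp p D (fun E => (`[< ~ grows (E0 :|: E)%SET S m >])%:R) <=
  x ^+ #|A| * (1 - p + p * x) ^+ #|C|.
Proof.
(* [q] is the factor paid by one unexposed pair: 1 if it is absent, [x] for the new active vertex if
   it is present. The hypothesis on [x] says that it is a supersolution of the extinction equation
   of a branching process. *)
move=> pb xb; set q := 1 - p + p * x.
have q0 : 0 <= q by rewrite /q; nra.
have q1 : q <= 1 by rewrite /q; nra.
have ex1 D' E0' S' m' : bexp p D' (fun E => (`[< ~ grows (E0' :|: E)%SET S' m' >])%:R) <= 1.
  by rewrite -[leRHS](bexp_cst p D'); apply: le_bexp => // E _; case: asboolP.
(* Lexicographic termination measure. The doubling makes a discovery decrease it although [A] grows;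
   passing to the next active vertex lowers [#|A|], which outweighs the growth of [C]. *)
pose mu (S A C : {set T}) := ((#|~: S|.*2 + #|A|) * #|T|.+1 + #|C|)%N.
have mu_lt (S' A' C' S1 A1 C1 : {set T}) :
    (#|~: S'|.*2 + #|A'| < #|~: S1|.*2 + #|A1|)%N -> (mu S' A' C' < mu S1 A1 C1)%N.
  move=> lt1; apply: (@leq_trans ((#|~: S'|.*2 + #|A'|).+1 * #|T|.+1)).
    by rewrite /mu mulSn [ltnRHS]addnC ltn_add2l ltnS max_card.
  by apply: leq_trans (leq_addr _ _); rewrite leq_mul2r lt1 orbT.
have [k] := ubnP (mu S A C).
elim: k v S A C m D E0 => // k IH v S A C m D E0 lek qx AS vS vA CS vC aD bD.
(* When [C] is exhausted, the next active vertex [a] is explored against all of [~: S], and the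
   hypothesis bounds the resulting power of [q] by the factor [x] of [a]. *)
have [C0|/set0Pn[c cC]] := eqVneq C finset.set0.
  rewrite {}C0 in lek CS vC *; rewrite cards0 expr0 mulr1.
  have [->|/set0Pn[a aA]] := eqVneq A finset.set0; first by rewrite cards0 expr0.
  have AD : #|A| = #|(A :\ a)%SET|.+1 by rewrite (cardsD1 a) aA.
  have aS : a \in S by exact: (fintype.subsetP AS).
  apply: (@le_trans _ _ (x ^+ #|(A :\ a)%SET| * q ^+ #|~: S|%SET)).
    apply: (IH a) => //; rewrite ?inE ?eqxx//.
    - by rewrite -ltnS (leq_trans _ lek)// ltnS mu_lt// AD ltn_add2l.
    - by rewrite (fintype.subset_trans (subD1set _ _)).
    - by move=> c; rewrite inE => cS; exact: aD.
    - by move=> a' b; rewrite inE => /andP[_ a'A] bS; exact: aD.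
  rewrite AD exprSr; apply: ler_wpM2l; first by rewrite exprn_ge0//; case/andP: xb.
  by apply: le_trans qx; apply: ler_wiXn2l => //; exact: leq_subr.
have cS : c \notin S by have := fintype.subsetP CS _ cC; rewrite inE.
have cv : c != v by apply: contraNneq cS => ->.
have cA : c \notin A by apply: contra cS => /(fintype.subsetP AS).
have CD : #|C| = #|(C :\ c)%SET|.+1 by rewrite (cardsD1 c) cC.
have SD : #|~: S|%SET = #|~: (c |: S)|%SET.+1.
  by rewrite (cardsD1 c (~: S)%SET) inE cS finset.setDE finset.setCU finset.setIC.
have [m0|m0] := posnP m.
  rewrite (_ : bexp _ _ _ = 0); last first.
    rewrite -[RHS](bexp_cst p D); apply: eq_bigr => E _; congr (_ * _).
    case: asboolP => // -[]; exists S, finset.set0; rewrite m0; exact: grown0.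
  by rewrite mulr_ge0// exprn_ge0//; case/andP: xb.
(* Expose the pair [[set v; c]]; [D] holds the unexposed pairs and [E0] the edges already found. If
   it is absent, [c] merely leaves [C]. *)
rewrite (bexpD1 _ _ (vC _ cC)) CD exprSr mulrA {2}/q mulrDr addrC mulrCA (mulrC (1 - p)).
have pair_neq a b : a \in S -> a != v -> b \notin S -> [set a; b]%SET != [set v; c]%SET.
  move=> aS av bS; apply/negP => /eqP /setP /(_ a); rewrite !inE eqxx (negbTE av) /=.
  by move=> /esym/eqP ac; rewrite -ac aS in cS.
apply: lerD.
- apply: ler_wpM2r; first by case/andP: pb; lra.
  apply: (IH v) => //; rewrite ?inE ?eqxx//.
  + by move: lek; rewrite /mu CD addnS ltnS.
  + by rewrite (fintype.subset_trans (subD1set _ _)).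
  + move=> c'; rewrite !inE => /andP[c'c c'C]; rewrite vC// andbT.
    apply/negP => /eqP /setP /(_ c'); rewrite !inE eqxx (negbTE c'c) orbT orbF.
    have := fintype.subsetP CS _ c'C; rewrite inE => c'S.
    by move=> /esym/eqP c'v; rewrite c'v vS in c'S.
  + move=> a b aA bS; rewrite !inE aD// andbT.
    apply: pair_neq => //; first exact: (fintype.subsetP AS).
    by apply: contraNneq vA => <-.
  + move=> b b' bS b'S bb'; rewrite !inE bD// andbT.
    apply/negP => /eqP /setP /(_ v); rewrite !inE eqxx /=.
    by move=> /orP[] /eqP vb; [rewrite -vb vS in bS|rewrite -vb vS in b'S].
- apply: ler_wpM2l; first by case/andP: pb.
  rewrite [leRHS]mulrC.
  have -> : x * (x ^+ #|A| * q ^+ #|(C :\ c)%SET|) =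
            x ^+ #|(c |: A)%SET| * q ^+ #|(C :\ c)%SET|.
    by rewrite cardsU1 cA exprS mulrA.
  (* If it is present, [c] becomes active and the edge joins [E0]; by [grown_front], [m.-1]
     discoveries from [c |: S] yield [m] from [S]. *)
  apply: (@le_trans _ _ (bexp p (D :\ [set v; c])%SET (fun E =>
      (`[< ~ grows (([set v; c]%SET |: E0) :|: E)%SET (c |: S)%SET m.-1 >])%:R))).
    apply: le_bexp => // E _; case: asboolP => [ng|_]; last exact: ler0n.
    rewrite asboolT// => -[S' [F gr]]; apply: ng.
    exists S', ([set v; c] |: F)%SET; rewrite -(prednK m0) finset.setUCA finset.setUA.
    by apply: grown_front => //; rewrite -finset.setUA finset.setU11.
  apply: (IH v) => //.
  + rewrite -ltnS (leq_trans _ lek)// ltnS mu_lt// SD cardsU1 cA.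
    by rewrite doubleS !addSn addnS.
  + by move: qx; rewrite -(prednK m0) SD subSS.
  + by rewrite finset.setUS.
  + by rewrite !inE vS orbT.
  + by rewrite !inE eq_sym (negbTE cv).
  + apply/fintype.subsetP => c'; rewrite !inE negb_or => /andP[-> /(fintype.subsetP CS)].
    by rewrite inE.
  + move=> c'; rewrite !inE => /andP[c'c c'C]; rewrite vC// andbT.
    apply/negP => /eqP /setP /(_ c'); rewrite !inE eqxx (negbTE c'c) orbT orbF.
    have := fintype.subsetP CS _ c'C; rewrite inE => c'S.
    by move=> /esym/eqP c'v; rewrite c'v vS in c'S.
  + move=> a b; rewrite !inE negb_or => aA /andP[bc bS]; apply/andP; split.
      apply/negP => /eqP /setP /(_ b); rewrite !inE eqxx (negbTE bc) orbT orbF.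
      by move=> /esym/eqP bv; rewrite bv vS in bS.
    case/orP: aA => [/eqP ->|aA]; last exact: aD.
    by apply: bD => //; rewrite eq_sym.
  + move=> b b'; rewrite !inE !negb_or => /andP[bc bS] /andP[b'c b'S] bb'.
    rewrite bD// andbT; apply/negP => /eqP /setP /(_ v); rewrite !inE eqxx /=.
    by move=> /orP[] /eqP vb; [rewrite -vb vS in bS|rewrite -vb vS in b'S].
Qed.

(** The exploration starts at an arbitrary root [a], the other roots being active and no pair
    exposed; the pairs from [a] to [~: A] supply the last factor [x]. *)
Lemma root_exploration (R : realType) (T : finType) (p x : R) (A : {set T})
    (m : nat) :
  0 <= p <= 1 -> 0 <= x <= 1 ->
  (1 - p + p * x) ^+ (#|~: A|%SET - m) <= x -> (0 < #|A|)%N ->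
  bexp p (vpairs T) (fun E => (`[< ~ grows E A m >])%:R) <= x ^+ #|A|.
Proof.
move=> pb xb qx /card_gt0P[a aA].
have q01 : 0 <= 1 - p + p * x <= 1 by apply/andP; split; nra.
apply: (@le_trans _ _ (x ^+ #|(A :\ a)%SET| * (1 - p + p * x) ^+ #|~: A|%SET)).
  rewrite (_ : (fun E => _) =
    (fun E => (`[< ~ grows (finset.set0 :|: E)%SET A m >])%:R)); last first.
    by apply: funext => E; rewrite finset.set0U.
  have vp (b c : T) : b != c -> [set b; c]%SET \in vpairs T.
    by move=> bc; rewrite inE cards2 bc.
  apply: (@exploration _ _ _ _ a) => //; rewrite ?inE ?eqxx ?subD1set//.
  - by move=> c; rewrite inE => cA; apply: vp; apply: contraNneq cA => <-.
  - move=> b c; rewrite inE => /andP[_ bA] cA; apply: vp.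
    by apply: contraNneq cA => <-.
  - by move=> b c _ _; exact: vp.
rewrite (cardsD1 a A) aA exprSr; apply: ler_wpM2l; first by rewrite exprn_ge0//; case/andP: xb.
by apply: le_trans qx; apply: ler_wiXn2l; rewrite ?leq_subr//; case/andP: q01.
Qed.

(** * Colourings obtained by cutting an odd cycle *)

(* Cutting the odd cycle at its edge {i, i+1} leaves a path, which is properly
   2-coloured; the edges mapped to the cut one are monochromatic. *)
Definition cut_coloring (T : finType) (r : nat) (f : T -> 'I_r) (i : 'I_r) :
    {set T} := [set v | odd (f v) (+) (f v <= i)%N]%SET.

(** Along the edge from [a] to [a + 1] the parity flips, and the threshold test flips as well only
    for [i = a]. At the closing edge both ends, [l.*2] and 0, are even, and the tests agree only for
    [i = l.*2]. *)
Lemma mono_cut_coloring (T : finType) (E : {set {set T}}) (l : nat)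
    (f : T -> 'I_(l.*2.+1)) (u v : T) :
  graph_hom E (cycle_graph l.*2.+1) f -> [set u; v]%SET \in E ->
  exists a, forall i, mono (cut_coloring f i) [set u; v]%SET = (i == a).
Proof.
move=> fE uvE; have /finset.imsetP[a _ fuv] := fE _ _ uvE.
exists a => i.
have adj (w w' : T) : f w = a -> f w' = ordS a ->
    mono (cut_coloring f i) [set w; w']%SET = (i == a).
  move=> fw fw'; rewrite mono_set2 !inE fw fw' /= -val_eqE /=.
  have := ltn_ord a; have := ltn_ord i; rewrite !ltnS => il al.
  have [al'|al'] := ltnP a l.*2.
    rewrite modn_small ?ltnS//=.
    by case: (odd a); case: ltngtP => //=; case: ltngtP => //=; lia.
  have -> : (a : nat) = l.*2 by lia.
  by rewrite modnn odd_double /= eqn_leq il eqb_id.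
have := set21 a (ordS a); rewrite -fuv !inE => /orP[/eqP au|/eqP av].
  have := set22 (f u) (f v); rewrite fuv !inE => /orP[/eqP va|/eqP va].
    have := set22 a (ordS a); rewrite -fuv !inE -au va orbb => /eqP aa.
    by apply: adj; rewrite ?va.
  by apply: adj.
rewrite finset.setUC; have := set21 (f u) (f v).
rewrite fuv !inE => /orP[/eqP ua|/eqP ua].
  have := set22 a (ordS a); rewrite -fuv !inE -av ua orbb => /eqP aa.
  by apply: adj; rewrite ?ua.
by apply: adj.
Qed.

Lemma sum_mono_cut_coloring (T : finType) (E G : {set {set T}}) (l : nat)
    (f : T -> 'I_(l.*2.+1)) :
  graph_hom E (cycle_graph l.*2.+1) f -> E \subset vpairs T -> G \subset E ->
  (\sum_i #|[set e in G | mono (cut_coloring f i) e]%SET| = #|G|)%N.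
Proof.
move=> fE /fintype.subsetP EV /fintype.subsetP GE.
under eq_bigr do rewrite -sum1dep_card big_mkcondr /=.
rewrite exchange_big /= -sum1_card; apply: eq_bigr => e eG.
have := EV _ (GE _ eG); rewrite inE => /cards2P[u [v [uv euv]]].
have [a amono] := mono_cut_coloring fE (v := v) (u := u) ltac:(by rewrite -euv; exact: GE).
by rewrite euv; under eq_bigr do rewrite amono; rewrite -big_mkcond big_pred1_eq.
Qed.

(** By Markov, each inequality fails for fewer than half of the indices. The proof averages
    [s.+1 * t i + m.+1 * u i]: these weights balance the two sums, and the successors cover [m = 0]
    and [s = 0]. *)
Lemma simultaneous_pigeonhole (r m s : nat) (t u : 'I_r -> nat) : (0 < r)%N ->
  (\sum_i t i <= m)%N -> (\sum_i u i <= s)%N ->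
  exists i, (r * t i <= 2 * m)%N /\ (r * u i <= 2 * s)%N.
Proof.
move=> r0 tm us; apply/not_existsP => nex.
have w i : ((2 * m * s + m + s).+1 <= r * (s.+1 * t i + m.+1 * u i))%N.
  have := nex i; case: (leqP (r * t i) (2 * m)) => [ti|ti _].
    by case: (leqP (r * u i) (2 * s)) => [ui []//|ui _]; nia.
  by nia.
have : (\sum_(i < r) (2 * m * s + m + s).+1 <=
        \sum_(i < r) r * (s.+1 * t i + m.+1 * u i))%N.
  by apply: leq_sum => i _; exact: w.
rewrite sum_nat_const card_ord -big_distrr big_split /= -!big_distrr /= leq_pmul2l//.
have := leq_mul (leqnn s.+1) tm; have := leq_mul (leqnn m.+1) us.
by rewrite !mulSn; lia.
Qed.

(** The pigeonhole is applied to [F] and to the edges of [E'] inside [S]. Intersecting the colouring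
    with [S] does not affect these edges and leaves only subsets of [S] for the union bound. *)
Lemma hom_coloring (T : finType) (E F E' : {set {set T}}) (S : {set T})
    (l m : nat) (f : T -> 'I_(l.*2.+1)) :
  graph_hom E (cycle_graph l.*2.+1) f -> E \subset vpairs T ->
  F \subset E -> (#|F| <= m)%N -> (forall e, e \in F -> e \subset S) ->
  E' \subset E ->
  exists sigma : {set T}, [/\ sigma \subset S,
    (l.*2.+1 * #|[set e in F | mono sigma e]%SET| <= 2 * m)%N &
    (l.*2.+1 * #|[set e in E' | (e \subset S) && mono sigma e]%SET| <=
      2 * #|[set e in E' | e \subset S]%SET|)%N].
Proof.
move=> fE EV FE Fm FS E'E.
have E'SE : [set e in E' | e \subset S]%SET \subset E.
  by apply: fintype.subset_trans E'E; apply/fintype.subsetP => e; rewrite inE => /andP[].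
have := @simultaneous_pigeonhole l.*2.+1 m _ _ _ isT
  (leq_trans (eq_leq (sum_mono_cut_coloring fE EV FE)) Fm)
  (eq_leq (sum_mono_cut_coloring fE EV E'SE)).
move=> [i [iF iE']]; exists (cut_coloring f i :&: S)%SET.
rewrite finset.subsetIr; split => //.
  rewrite (_ : [set e in F | _]%SET = [set e in F | mono (cut_coloring f i) e]%SET)//.
  by apply/setP => e; rewrite !inE; case: (boolP (e \in F)) => //= /FS; exact: monoI.
rewrite (_ : [set e in E' | _ & _]%SET =
   [set e in [set e in E' | e \subset S] | mono (cut_coloring f i) e]%SET)//.
apply/setP => e; rewrite !inE -andbA; congr (_ && _).
by case: (boolP (e \subset S)) => //= eS; rewrite monoI.
Qed.

(** * Second round: weighted union bound over colourings *)

(* The product of these weights over a set of edges is at least 1 when few of the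
   edges inside S are monochromatic, but the weight of a random pair inside S is
   less than 1 on average. *)
Definition color_weight (R : realType) (T : finType) (S sigma e : {set T}) : R :=
  if e \subset S then if mono sigma e then 1 / 4 else 5 / 4 else 1.

Lemma prod_color_weight_ge1 (R : realType) (T : finType) (r : nat)
    (S sigma : {set T}) (E : {set {set T}}) : (16 <= r)%N ->
  (r * #|[set e in E | (e \subset S) && mono sigma e]%SET| <=
    2 * #|[set e in E | e \subset S]%SET|)%N ->
  1 <= \prod_(e in E) color_weight R S sigma e.
Proof.
move=> r16 rE; rewrite /color_weight -big_mkcondr /=.
rewrite (bigID (mono sigma)) /=.
rewrite (eq_bigr (fun=> 1 / 4 : R)); last by move=> e /andP[_ ->].
rewrite (eq_bigr (fun=> 5 / 4 : R) (P := fun e => (e \in E) && _ && ~~ _)); last first.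
  by move=> e /andP[_ /negbTE ->].
rewrite !prodr_const.
set a := #|_|; set b := #|_|.
have aE : a = #|[set e in E | (e \subset S) && mono sigma e]%SET|.
  by apply: eq_card => e; rewrite !inE andbA.
have abE : (a + b)%N = #|[set e in E | e \subset S]%SET|.
  rewrite -[RHS](cardID (mono sigma)); congr (_ + _)%N; apply: eq_card => e.
    by rewrite !inE.
  by rewrite !inE andbC.
rewrite -aE -abE in rE.
(* [16 * a <= 2 * (a + b)] leaves at least seven bichromatic edges per monochromatic one, and
   [(5 / 4) ^+ 7] exceeds 4. *)
have ab : (7 * a <= b)%N by nia.
have : 1 <= ((1 / 4) * (5 / 4) ^+ 7) ^+ a :> R.
  by rewrite exprn_ege1// !exprS expr0; lra.
rewrite exprMn -exprM => /le_trans; apply; apply: ler_wpM2l.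
  by rewrite exprn_ge0//; lra.
by rewrite ler_weXn2l//; lra.
Qed.

Lemma sum_vpairs (R : realType) (T : finType) (h : {set T} -> R) :
  \sum_u \sum_(v | v != u) h [set u; v]%SET = (\sum_(e in vpairs T) h e) * 2.
Proof.
rewrite pair_big_dep /=.
rewrite (partition_big (fun uv => [set uv.1; uv.2]%SET) (mem (vpairs T))) /=; last first.
  by move=> [u v] /= uv; rewrite inE cards2 [u == v]eq_sym uv.
rewrite mulr_suml; apply: eq_bigr => e; rewrite inE => /cards2P[a [b [ab ->]]].
rewrite (eq_bigl (mem [set (a, b); (b, a)]%SET)); last first.
  move=> [u v] /=; rewrite !inE !xpair_eqE; apply/andP/orP.
    move=> [vu /eqP /setP uvab].
    have := uvab a; have := uvab b; have := uvab u; have := uvab v.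
    rewrite !inE !eqxx !orbT /=.
    move=> /esym/orP[]/eqP ?; subst v.
      by move=> /esym/orP[]/eqP ?; subst u; rewrite ?eqxx in vu *; right.
    by move=> /esym/orP[]/eqP ?; subst u; rewrite ?eqxx in vu *; left.
  move=> []/andP[/eqP -> /eqP ->]; first by rewrite eq_sym ab.
  by rewrite ab finset.setUC.
rewrite big_setU1/= ?inE ?xpair_eqE ?(negbTE ab)// big_set1 /= (finset.setUC [set b]%SET).
by ring.
Qed.

(** Encoding colours by signs [d u] makes the centred weight a combination of [c u * c v] and
    [d u * d v]. Summed over ordered pairs, the second part gives minus half of a square, which is
    dropped; restoring the diagonal produces the linear term. *)
Lemma sum_color_weight (R : realType) (T : finType) (S sigma : {set T}) :
  \sum_(e in vpairs T) (color_weight R S sigma e - 1) <=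
  (3 * #|S|%:R - #|S|%:R ^+ 2) / 8.
Proof.
pose c (u : T) : R := (u \in S)%:R.
pose d (u : T) : R := if u \in S then if u \in sigma then 1 else - 1 else 0.
have hE u v : color_weight R S sigma [set u; v]%SET - 1 =
    - (1 / 4) * (c u * c v) - (1 / 2) * (d u * d v).
  rewrite /color_weight /c /d mono_set2 finset.subUset !finset.sub1set.
  case: (u \in S); case: (v \in S); case: (u \in sigma); case: (v \in sigma) => /=; lra.
have cS : \sum_u c u = #|S|%:R.
  rewrite -sum1_card natr_sum [RHS]big_mkcond /=; apply: eq_bigr => u _.
  by rewrite /c; case: ifP.
have diag u : color_weight R S sigma [set u; u]%SET - 1 = - (3 / 4) * c u.
  by rewrite hE /c /d; case: (u \in S); case: (u \in sigma) => /=; lra.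
have := sum_vpairs (fun e => color_weight R S sigma e - 1).
under eq_bigr => u _.
  have -> : \sum_(v | v != u) (color_weight R S sigma [set u; v]%SET - 1) =
     - (1 / 4) * (c u * #|S|%:R) - (1 / 2) * (d u * \sum_v d v) + (3 / 4) * c u.
    apply: (@addrI _ (color_weight R S sigma [set u; u]%SET - 1)).
    rewrite -(bigD1 u (P := predT))//= diag; under eq_bigr do rewrite hE.
    by rewrite sumrB -!mulr_sumr cS; ring.
  over.
rewrite /= big_split sumrB /= -!mulr_sumr -!mulr_suml cS => sE.
have := sqr_ge0 (\sum_v d v); rewrite expr2 => D0.
by rewrite ler_pdivlMr//; nra.
Qed.

Definition hom_to_odd_cycle (T : finType) (ell : nat) (E : {set {set T}}) :=
  exists l : nat, (ell <= l)%N /\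
    exists f : T -> 'I_(l.*2.+1), graph_hom E (cycle_graph l.*2.+1) f.

Lemma color_weight_gt0 (R : realType) (T : finType) (S sigma e : {set T}) :
  0 < color_weight R S sigma e.
Proof. by rewrite /color_weight; case: ifP => // _; case: ifP => _; lra. Qed.

(** Exponential Markov bound. For the colouring given by [hom_coloring], both [w sigma] and the
    product of colour weights are at least 1, so their sum over [sigma] dominates the indicator. Its
    expectation factorises by [bexp_prod], and [grown_mono_sum] with [z = Y^-1 ^+ r] sums the
    weights of the forest. *)
Lemma second_round (R : realType) (T : finType) (E1 F : {set {set T}})
    (A S : {set T}) (m ell : nat) (p Y : R) :
  grown E1 A S F m -> E1 \subset vpairs T -> 0 <= p <= 1 -> 1 <= Y ->
  (16 <= ell.*2.+1)%N ->
  bexp p (vpairs T) (fun E2 => (`[< hom_to_odd_cycle ell (E1 :|: E2)%SET >])%:R) <=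
  Y ^+ (2 * m) * (2 ^+ #|A| * (1 + Y^-1 ^+ ell.*2.+1) ^+ m) *
  expR (p * ((3 * (#|A| + m)%:R - (#|A| + m)%:R ^+ 2) / 8)).
Proof.
move=> gr E1V pb Y1 r16; set r := ell.*2.+1.
have Y0 : 0 < Y by lra.
pose w sigma : R := Y ^+ (2 * m) *
  \prod_(e in F) (if mono sigma e then Y^-1 ^+ r else 1).
have w0 sigma : 0 <= w sigma.
  apply: mulr_ge0; first by rewrite exprn_ge0// ltW.
  by apply: prodr_ge0 => e _; case: ifP => // _; rewrite exprn_ge0// invr_ge0 ltW.
have W0 sigma (E : {set {set T}}) : 0 <= \prod_(e in E) color_weight R S sigma e.
  by apply: prodr_ge0 => e _; rewrite ltW// color_weight_gt0.
apply: (@le_trans _ _ (bexp p (vpairs T) (fun E2 =>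
    \sum_(sigma in powerset S) w sigma * \prod_(e in E2) color_weight R S sigma e))).
  apply: le_bexp => // E2 E2V; case: asboolP => [[l [ell_l [f fE]]]|_]; last first.
    by apply: sumr_ge0 => sigma _; rewrite mulr_ge0.
  have EV : E1 :|: E2 \subset vpairs T by rewrite finset.subUset E1V.
  have FE : F \subset E1 :|: E2.
    exact: (fintype.subset_trans (grown_edges gr) (finset.subsetUl _ _)).
  have [sigma [sS sF sE2]] := hom_coloring fE EV FE (grown_cardF gr)
    (grown_inside gr) (finset.subsetUr E1 E2).
  rewrite (bigD1 sigma) ?powersetE//= -[leLHS]addr0 lerD//; last first.
    by apply: sumr_ge0 => tau _; rewrite mulr_ge0.
  (* A longer cycle only strengthens the two inequalities, so all [l >= ell] are treated at once. *)
  have rl : (r <= l.*2.+1)%N by rewrite ltnS leq_double.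
  rewrite -[leLHS]mulr1 ler_pM//; last first.
    by apply: (prod_color_weight_ge1 R (r := l.*2.+1)) => //; exact: leq_trans rl.
  rewrite /w -big_mkcondr /= prodr_const -exprM -[X in X ^+ (r * _)]invrK.
  rewrite invrK exprVn -ler_pdivrMr ?invr_gt0 ?exprn_gt0// invrK mul1r.
  apply: ler_weXn2l => //; apply: leq_trans sF; apply: leq_mul => //.
  by apply: eq_leq; apply: eq_card => e; rewrite !inE.
rewrite bexp_sum.
under eq_bigr do rewrite bexpZ bexp_prod.
rewrite -(grown_mono_sum (Y^-1 ^+ r) gr) mulr_sumr mulr_suml.
apply: ler_sum => sigma _; apply: ler_wpM2l => //.
rewrite -(grown_card gr).
apply: (@le_trans _ _ (\prod_(e in vpairs T) expR (p * (color_weight R S sigma e - 1)))).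
  apply: ler_prod => e _; rewrite expR_ge1Dx andbT.
  by have := color_weight_gt0 R S sigma e; case/andP: pb; nra.
rewrite -expR_sum ler_expR -mulr_sumr; apply: ler_wpM2l; first by case/andP: pb.
exact: sum_color_weight.
Qed.

Lemma hom_prob_le (R : realType) (T : finType) (A : {set T}) (m ell : nat)
    (p p1 p2 x Y : R) :
  1 - p = (1 - p1) * (1 - p2) -> 0 <= p1 <= 1 -> 0 <= p2 <= 1 -> 0 <= x <= 1 ->
  1 <= Y -> (16 <= ell.*2.+1)%N -> (0 < #|A|)%N ->
  (1 - p1 + p1 * x) ^+ (#|~: A|%SET - m) <= x ->
  bexp p (vpairs T) (fun E => (`[< hom_to_odd_cycle ell E >])%:R) <=
  x ^+ #|A| +
  Y ^+ (2 * m) * (2 ^+ #|A| * (1 + Y^-1 ^+ ell.*2.+1) ^+ m) *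
  expR (p2 * ((3 * (#|A| + m)%:R - (#|A| + m)%:R ^+ 2) / 8)).
Proof.
move=> pE p1b p2b xb Y1 r16 A0 qx; rewrite (bexp_sprinkle _ _ pE).
set b := (X in _ + X).
have b0 : 0 <= b.
  have Yr : 0 <= Y^-1 by rewrite invr_ge0; lra.
  by rewrite /b !mulr_ge0 ?expR_ge0 ?exprn_ge0 ?addr_ge0 ?exprn_ge0//; lra.
apply: le_trans (lerD (root_exploration (x := x) p1b xb qx A0) (lexx b)).
rewrite -[X in _ <= _ + X](bexp_cst p1 (vpairs T)) -bexpD.
apply: le_bexp => // E1 E1V; case: asboolP => [_|/contrapT[S [F gr]]].
  apply: (@le_trans _ _ 1); last by rewrite lerDl.
  by rewrite -[leRHS](bexp_cst p2 (vpairs T)); apply: le_bexp => // E2 _; case: asboolP.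
by rewrite add0r; exact: second_round gr _ _ _ _.
Qed.

(** * Numerical estimates for the binomial random graph *)

Lemma gnp_probE (R : realType) (n : nat) (p : R) (P : {set {set 'I_n}} -> Prop) :
  gnp_prob n p P = bexp p (vpairs 'I_n) (fun E => (`[< P E >])%:R).
Proof.
rewrite /gnp_prob big_mkcondr; apply: eq_bigr => E _.
by case: asboolP => _; rewrite ?mulr1 ?mulr0.
Qed.

Lemma gnp_prob_not (R : realType) (n : nat) (p : R) (P : {set {set 'I_n}} -> Prop) :
  gnp_prob n p (fun E => ~ P E) = 1 - gnp_prob n p P.
Proof.
rewrite !gnp_probE; apply/eqP; rewrite eq_sym subr_eq -bexpD; apply/eqP.
transitivity (bexp p (vpairs 'I_n) (fun=> 1)); first by rewrite bexp_cst.
apply: eq_bigr => E _; congr (_ * _).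
by rewrite asbool_neg; case: (asbool (P E)); rewrite ?addr0 ?add0r.
Qed.

(** A reciprocal Bernoulli inequality; the induction rests on [(1 - a) * (1 + N.+1%:R * a) <= 1 +
    N%:R * a]. *)
Lemma exprn_1B_le (R : realFieldType) (a : R) (N : nat) :
  0 <= a <= 1 -> (1 - a) ^+ N * (1 + N%:R * a) <= 1.
Proof.
move=> /andP[a0 a1]; elim: N => [|N IH]; first by rewrite expr0 mul0r addr0 mulr1.
apply: le_trans IH; rewrite exprSr -mulrA ler_wpM2l ?exprn_ge0 ?subr_ge0//.
by rewrite -natr1; have := ler0n R N; nra.
Qed.

Lemma expRN_le_sqr (R : realType) (u : R) : 0 < u -> expR (- u) <= 4 / u ^+ 2.
Proof.
move=> u0; have u2 : u / 2 <= expR (u / 2).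
  by apply: le_trans (expR_ge1Dx _); lra.
rewrite expRN ler_pdivlMr ?exprn_gt0// mulrC ler_pdivrMr ?expR_gt0//.
have -> : expR u = expR (u / 2) * expR (u / 2) by rewrite -expRD -splitr.
by have := expR_gt0 (u / 2); nra.
Qed.

(* The contribution of the colourings of the forest is negligible against the
   gain from the second round. *)
Lemma second_round_exponent (R : realType) (d p2 Y : R) (k m t n r : nat) :
  0 < d <= 1 -> (0 < n)%N ->
  (6 <= t)%N ->
  m%:R <= d * n%:R / 32 -> d * n%:R / 32 <= t%:R -> d / (2 * n%:R) <= p2 ->
  2 ^+ 19 / d ^+ 3 <= r%:R ->
  Y = expR (d ^+ 2 / 2 ^+ 12) ->
  Y ^+ (2 * m) * (2 ^+ k * (1 + Y^-1 ^+ r) ^+ m) *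
    expR (p2 * ((3 * t%:R - t%:R ^+ 2) / 8)) <=
  2 ^+ k * expR (- (d ^+ 3 * n%:R / 2 ^+ 17)).
Proof.
move=> /andP[d0 d1] n0 t6 md td p2d rd YE.
have n0' : 0 < n%:R :> R by rewrite ltr0n.
pose c : R := d ^+ 2 / 2 ^+ 12.
have c0 : 0 < c by rewrite /c divr_gt0 ?exprn_gt0.
(* Here the cubic order arises: [r >= 2 ^+ 19 / d ^+ 3] gives [r * c >= 2 ^+ 7 / d], and
   [4 / u ^+ 2] at [u = 2 ^+ 7 / d] is exactly [c]. *)
have Yr : Y^-1 ^+ r <= c.
  rewrite YE -expRN -expRM_natl mulrN.
  have u0 : 2 ^+ 7 / d <= r%:R * (d ^+ 2 / 2 ^+ 12).
    apply: le_trans (ler_wpM2r (ltW c0) rd); rewrite /c le_eqVlt; apply/orP; left.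
    by apply/eqP; field; lra.
  apply: le_trans (_ : expR (- (2 ^+ 7 / d)) <= _); first by rewrite ler_expR lerN2.
  apply: le_trans (expRN_le_sqr _) _; first by rewrite divr_gt0 ?exprn_gt0.
  by rewrite /c le_eqVlt; apply/orP; left; apply/eqP; field; lra.
have Ym : Y ^+ (2 * m) = expR (m%:R * (2 * c)).
  by rewrite YE -expRM_natl natrM; congr expR; rewrite /c; ring.
have Zm : (1 + Y^-1 ^+ r) ^+ m <= expR (m%:R * c).
  rewrite expRM_natl; apply: lerXn2r; rewrite ?nnegrE ?expR_ge0//.
    by rewrite addr_ge0// exprn_ge0// invr_ge0 YE expR_ge0.
  by apply: le_trans (expR_ge1Dx _); rewrite lerD2l.
rewrite mulrCA -[leLHS]mulrA; apply: ler_wpM2l; first by rewrite exprn_ge0.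
apply: (@le_trans _ _ (expR (m%:R * (2 * c)) * expR (m%:R * c) *
    expR (p2 * ((3 * t%:R - t%:R ^+ 2) / 8)))).
  apply: ler_wpM2r; first exact: expR_ge0.
  by rewrite Ym; apply: ler_wpM2l; first exact: expR_ge0.
rewrite -!expRD ler_expR.
(* In units of [d ^+ 3 * n%:R / 2 ^+ 17], the colourings cost at most 3 and the second round gains
   at least 4; one unit remains. *)
have mc : m%:R * (2 * c) + m%:R * c <= 3 * (d ^+ 3 * n%:R / 2 ^+ 17).
  have := ler_wpM2r (ltW c0) md.
  have -> : d * n%:R / 32 * c = d ^+ 3 * n%:R / 2 ^+ 17 by rewrite /c; field.
  by lra.
have t6' : 6 <= t%:R :> R by rewrite (ler_nat _ 6).
have tt : (3 * t%:R - t%:R ^+ 2) / 8 <= - ((d * n%:R / 32) ^+ 2 / 16).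
  have : (d * n%:R / 32) ^+ 2 <= t%:R ^+ 2.
    by apply: lerXn2r; rewrite ?nnegrE// ?divr_ge0// mulr_ge0// ltW.
  by move: (t%:R : R) t6' ((_ ^+ 2) : R) => s s6 w; nra.
have pp : p2 * ((3 * t%:R - t%:R ^+ 2) / 8) <= - (4 * (d ^+ 3 * n%:R / 2 ^+ 17)).
  have dn0 : 0 < d / (2 * n%:R) by rewrite divr_gt0// mulr_gt0.
  apply: (@le_trans _ _ (p2 * - ((d * n%:R / 32) ^+ 2 / 16))).
    by apply: ler_wpM2l tt; lra.
  rewrite mulrN lerN2.
  have -> : 4 * (d ^+ 3 * n%:R / 2 ^+ 17) =
     d / (2 * n%:R) * ((d * n%:R / 32) ^+ 2 / 16) by field; lra.
  by apply: ler_wpM2r p2d; rewrite divr_ge0// exprn_ge0// divr_ge0// mulr_ge0// ltW.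
by lra.
Qed.

Lemma exists_card_ord (n k : nat) : (k <= n)%N -> exists A : {set 'I_n}, #|A| = k.
Proof.
move=> kn; exists [set widen_ord kn i | i in 'I_k]%SET.
by rewrite card_imset ?card_ord// => i j /(congr1 val) /= ?; apply: val_inj.
Qed.

(* The exploration is supercritical as long as it has discovered at most
   d n / 16 vertices. *)
Lemma exploration_supercritical (R : realType) (d n : R) (N : nat) :
  0 < d <= 1 -> 2 <= n -> n - d * n / 16 <= N%:R ->
  (1 - (1 + d / 2) / n * (d / 8)) ^+ N <= 1 - d / 8.
Proof.
move=> /andP[d0 d1] n2 nN; have n0 : 0 < n by lra.
set a := (1 + d / 2) / n * (d / 8).
have a0 : 0 <= a by rewrite /a mulr_ge0 ?divr_ge0//; lra.
have a1 : a <= 1.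
  have : (1 + d / 2) / n <= 1 by rewrite ler_pdivrMr//; lra.
  by rewrite /a => ?; nra.
have := @exprn_1B_le R a N; rewrite a0 a1 => /(_ isT).
have Na : (1 + d / 4) * (d / 8) <= N%:R * a.
  (* The mean number of new neighbours stays at least [1 + d / 4]. *)
  have : (1 + d / 4) <= N%:R * ((1 + d / 2) / n).
    rewrite mulrA ler_pdivlMr//.
    apply: (@le_trans _ _ ((n - d * n / 16) * (1 + d / 2))); last first.
      by apply: ler_wpM2r => //; lra.
    have -> : (n - d * n / 16) * (1 + d / 2) =
      (1 + d / 4) * n + n * (d * (6 - d) / 32) by field.
    by rewrite lerDl mulr_ge0 ?(ltW n0)// divr_ge0// mulr_ge0//; lra.
  by move=> h; rewrite /a [leRHS]mulrA; apply: ler_wpM2r h; lra.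
have z0 : 0 <= (1 - a) ^+ N by rewrite exprn_ge0// subr_ge0.
move: ((1 - a) ^+ N) (N%:R * a) z0 Na => z w z0 Na zw.
have zw' : z * (1 + (1 + d / 4) * (d / 8)) <= 1.
  by apply: le_trans zw; apply: ler_wpM2l => //; lra.
have b0 : 0 < 1 + (1 + d / 4) * (d / 8) by nra.
rewrite -(ler_pM2r b0); apply: le_trans zw' _.
have -> : (1 - d / 8) * (1 + (1 + d / 4) * (d / 8)) =
  1 + d ^+ 2 * (4 - d) / 256 by field.
by rewrite lerDl; apply: divr_ge0 (ler0n _ _); apply: mulr_ge0; [exact: sqr_ge0|lra].
Qed.

Lemma gnp_hom_prob_le (R : realType) (eps d : R) (ell k n : nat) :
  0 < d <= 1 -> d <= eps -> 2 ^+ 19 / d ^+ 3 <= ell%:R -> (0 < k)%N ->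
  2 + eps <= n%:R -> 32 * (k + 7)%:R <= d * n%:R ->
  gnp_prob n ((1 + eps) / n%:R) (hom_to_odd_cycle ell) <=
  (1 - d / 8) ^+ k + 2 ^+ k * expR (- (d ^+ 3 * n%:R / 2 ^+ 17)).
Proof.
move=> d01 deps ld k0 n_eps n_k; case/andP: (d01) => d0 d1; rewrite gnp_probE.
have n0 : 0 < n%:R :> R by lra.
rewrite natrD in n_k.
have dn : d * n%:R <= n%:R by rewrite -[leRHS]mul1r; apply: ler_wpM2r d1; exact: ltW.
have kn : (k <= n)%N by rewrite -(ler_nat R); lra.
have [A cA] := exists_card_ord kn.
have dn0 : 0 <= d * n%:R / 32 by rewrite divr_ge0// mulr_ge0// ltW.
(* [m] is the integer part of [d * n / 32]. Since [k >= 1], [k + m] is above [d * n / 32], and it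
   stays below [d * n / 16], where the exploration is supercritical. *)
have [m /andP[m_le lt_m]] : exists m : nat, m%:R <= d * n%:R / 32 < m%:R + 1.
  by exists (Num.truncn (d * n%:R / 32)); rewrite natr1 truncn_itv.
have k1 : 1 <= k%:R :> R by rewrite (ler_nat _ 1).
pose p : R := (1 + eps) / n%:R; pose p1 : R := (1 + d / 2) / n%:R.
(* The solution of [1 - p = (1 - p1) * (1 - p2)]; it is at least [p - p1], hence at least
   [d / (2 * n)]. *)
pose p2 := (p - p1) / (1 - p1); rewrite -/p.
have p1_0 : 0 <= p1 by rewrite /p1 divr_ge0//; lra.
have p1_1 : p1 < 1 by rewrite /p1 ltr_pdivrMr//; lra.
have p_1 : p <= 1 by rewrite /p ler_pdivrMr//; lra.
have pp1 : d / (2 * n%:R) <= p - p1.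
  rewrite /p /p1 -mulrBl invfM mulrA; apply: ler_wpM2r; last by lra.
  by rewrite invr_ge0 ltW.
have pp1_0 : 0 <= p - p1 by apply: le_trans pp1; rewrite divr_ge0// ?mulr_ge0// ltW.
have p1B : 0 < 1 - p1 by lra.
have p2_0 : 0 <= p2 by rewrite /p2 divr_ge0// ltW.
have p2_1 : p2 <= 1 by rewrite /p2 ler_pdivrMr//; lra.
have p2_ge : d / (2 * n%:R) <= p2.
  by apply: le_trans pp1 _; rewrite /p2 ler_pdivlMr//; nra.
have ell16 : (16 <= ell)%N.
  rewrite -(ler_nat R); apply: le_trans ld.
  have d3 : d ^+ 3 <= 1 by rewrite exprn_ile1// ltW.
  rewrite ler_pdivlMr ?exprn_gt0//; apply: (@le_trans _ _ 16); last by lra.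
  by rewrite ler_piMr.
have r_ge : (ell <= ell.*2.+1)%N by rewrite -addnn -addSn leq_addl.
pose Y := expR (d ^+ 2 / 2 ^+ 12).
have bound := @hom_prob_le R _ A m ell p p1 p2 (1 - d / 8) Y.
rewrite cA in bound.
apply: le_trans (bound _ _ _ _ _ _ _ _) _; rewrite ?p2_0 ?p1_0 ?(ltW p1_1)//.
- by rewrite /p2; have := p1B; move: (p) (p1) => u v uv; clear -uv; field; lra.
- by clear -d0 d1; apply/andP; split; lra.
- by rewrite -expR0 ler_expR divr_ge0// exprn_ge0// ltW.
- exact: leq_trans r_ge.
- have -> : 1 - p1 + p1 * (1 - d / 8) = 1 - p1 * (d / 8) by ring.
  apply: exploration_supercritical => //; first by clear -n_eps d0 deps; lra.
  have nA : (k + #|~: A|%SET = n)%N by rewrite -cA cardsC card_ord.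
  have nN : n%:R <= (#|~: A|%SET - m)%:R + k%:R + m%:R :> R.
    by rewrite -!natrD ler_nat; move: (#|~: A|%SET) nA => N nA; clear -nA; lia.
  by move: (#|~: A|%SET - m)%N nN => N nN; clear -m_le n_k nN; lra.
rewrite lerD2l; apply: second_round_exponent => //.
- by rewrite -(ltr0n R).
- by rewrite -(ler_nat R) natrD; clear -m_le lt_m n_k k1; lra.
- by rewrite natrD; clear -lt_m k1; lra.
- by apply: le_trans ld _; rewrite ler_nat.
Qed.

(** * The threshold, the limit and the cubic order *)

Definition cycle_threshold (R : realType) (eps : R) : nat :=
  (Num.truncn (2 ^+ 19 / Num.min eps 1 ^+ 3)).+1.

Lemma gnp_hom_prob_cvg0 (R : realType) (eps : R) : 0 < eps ->
  (gnp_prob n ((1 + eps) / n%:R)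
     (hom_to_odd_cycle (cycle_threshold eps)) @[n --> \oo] --> (0 : R))%classic.
Proof.
move=> eps0; set ell := cycle_threshold eps.
pose d := Num.min eps 1.
have d01 : 0 < d <= 1 by rewrite /d lt_min eps0 ltr01 ge_min lexx orbT.
have deps : d <= eps by rewrite /d ge_min lexx.
have ld : 2 ^+ 19 / d ^+ 3 <= ell%:R.
  by rewrite ltW// /ell /cycle_threshold truncnS_gt.
case/andP: (d01) => d0 d1.
apply/cvgrPdist_lt => e e0.
(* [k] is fixed before [n] grows: [k * d * e > 16] and the reciprocal Bernoulli inequality force
   [(1 - d / 8) ^+ k < e / 2]. *)
pose k := (Num.truncn (16 / (d * e))).+1.
have k_gt : 16 / (d * e) < k%:R by exact: truncnS_gt.
have xk : (1 - d / 8) ^+ k < e / 2.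
  have := @exprn_1B_le R (d / 8) k; rewrite divr_ge0 ?(ltW d0)//=.
  have -> : d / 8 <= 1 by lra.
  move=> /(_ isT); rewrite ltr_pdivrMr ?mulr_gt0// in k_gt.
  have : 0 <= (1 - d / 8) ^+ k by rewrite exprn_ge0//; lra.
  move: ((1 - d / 8) ^+ k) => z z0 zk; rewrite ltNge; apply/negP => ez.
  have : e / 2 * (1 + k%:R * (d / 8)) <= 1.
    by apply: le_trans zk; apply: ler_wpM2r => //; rewrite addr_ge0// mulr_ge0//; lra.
  have -> : e / 2 * (1 + k%:R * (d / 8)) = e / 2 + k%:R * (d * e) / 16 by field.
  by lra.
pose c := d ^+ 3 / 2 ^+ 17.
have c0 : 0 < c by rewrite divr_gt0 ?exprn_gt0.
near=> n.
have gnp0 : 0 <= gnp_prob n ((1 + eps) / n%:R) (hom_to_odd_cycle ell).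
  rewrite gnp_probE -(bexp_cst ((1 + eps) / n%:R) (vpairs 'I_n) 0).
  apply: le_bexp => [|E _]; last exact: ler0n.
  have n_eps : 2 + eps <= n%:R by near: n; exact: nbhs_infty_ger.
  by rewrite divr_ge0//= ?ler_pdivrMr//; lra.
rewrite sub0r normrN ger0_norm//.
apply: le_lt_trans (gnp_hom_prob_le d01 deps ld (k := k) _ _ _) _ => //.
- by near: n; exact: nbhs_infty_ger.
- have : 32 * (k + 7)%:R / d <= n%:R by near: n; exact: nbhs_infty_ger.
  by rewrite ler_pdivrMr// [d * _]mulrC.
rewrite [ltRHS](splitr e) ltrD//.
have n_ge : 2 ^+ k / (e / 2) / c <= n%:R by near: n; exact: nbhs_infty_ger.
rewrite expRN ltr_pdivrMr ?expR_gt0// mulrC -ltr_pdivrMr ?divr_gt0//.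
apply: lt_le_trans (expR_ge1Dx _).
rewrite ler_pdivrMr// in n_ge.
have -> : d ^+ 3 * n%:R / 2 ^+ 17 = n%:R * c by rewrite /c; ring.
by lra.
Unshelve. all: by end_near. Qed.

Local Open Scope classical_set_scope.
Local Open Scope ring_scope.

Theorem theorem1p4 (R : realType) :
  exists ell : R -> nat,
    (forall eps : R, 0 < eps ->
       (0 < ell eps)%N /\
       (gnp_prob n ((1 + eps) / n%:R)
          [set E : {set {set 'I_n}} |
            forall l : nat, (ell eps <= l)%N ->
              ~ exists f : 'I_n -> 'I_(l.*2.+1),
                  graph_hom E (cycle_graph l.*2.+1) f]
        @[n --> \oo] --> (1 : R))) /\
    (fun eps : R => (ell eps)%:R : R) =O_ (0^'+) (fun eps : R => eps ^- 3).
Proof.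
exists (@cycle_threshold R); split=> [eps eps0|].
  split=> //.
  rewrite (_ : (fun n => _) = (fun n => 1 - gnp_prob n ((1 + eps) / n%:R)
      (hom_to_odd_cycle (cycle_threshold eps)))).
    rewrite -[X in _ --> X]subr0; apply: cvgB; first exact: cvg_cst.
    exact: gnp_hom_prob_cvg0.
  apply: funext => n; rewrite -gnp_prob_not; congr gnp_prob.
  apply/seteqP; split=> E /=; first by move=> nE [l [ell_l]]; exact: nE.
  by move=> nE l ell_l fE; apply: nE; exists l.
apply/eqOP; near=> k; near=> eps.
have eps0 : 0 < eps by near: eps; exact: nbhs_right_gt.
have eps1 : eps <= 1 by near: eps; exact: nbhs_right_le.
rewrite ger0_norm// ger0_norm ?invr_ge0 ?exprn_ge0 ?(ltW eps0)//.
rewrite /cycle_threshold (min_idPl eps1) -natr1.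
(* The successor in the threshold is absorbed by [eps ^- 3 >= 1], giving the constant
   [2 ^+ 19 + 1]. *)
have e3 : 1 <= eps ^- 3 by rewrite invf_ge1 ?exprn_gt0// exprn_ile1// ltW.
have le_tr : (Num.truncn (2 ^+ 19 / eps ^+ 3))%:R <= 2 ^+ 19 * eps ^- 3 :> R.
  by rewrite truncn_le mulr_ge0 ?exprn_ge0//; lra.
apply: (@le_trans _ _ ((2 ^+ 19 + 1) * eps ^- 3)); first by rewrite mulrDl; lra.
apply: ler_wpM2r; first by lra.
by near: k; apply: nbhs_pinfty_ge; exact: num_real.
Unshelve. all: by end_near. Qed.
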